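(* Let $\alpha,c,\tau>0$ and consider the diffusion operator $Lu=-\nabla\cdot(d\nabla u)$, with $d$ bounded, symmetric and uniformly positive definite, on a bounded domain $\Omega\subset\mathbb{R}^k$, $k\in\{1,2,3\}$, with homogeneous Dirichlet, homogeneous Neumann, or periodic boundary conditions. Let $V_h\subset H^1(\Omega)$ be a piecewise linear finite element space accounting for the essential boundary conditions, with nodal basis $\varphi_1,\dots,\varphi_N$, let $M_h=\left(\int_\Omega\varphi_j\varphi_i\right)_{i,j}$ be the mass matrix and $L_h=\left(\int_\Omega d\nabla\varphi_j\cdot\nabla\varphi_i\right)_{i,j}$ the matrix of $L$. Let $\mathcal{M}_h=\begin{pmatrix}M_h&0\\0&M_h\end{pmatrix}$, $\mathcal{L}_h=\begin{pmatrix}L_h&0\\0&0\end{pmatrix}$, $\mathcal{C}=\alpha\begin{pmatrix}cI&-I\\-cI&I\end{pmatrix}$, and let $W_h^n=[U_h^n,V_h^n]^T\in\mathbb{R}^N\times\mathbb{R}^N$ satisfy the fully implicit finite element scheme $$\frac1\tau\mathcal{M}_h(W_h^n-W_h^{n-1})+\mathcal{C}\mathcal{M}_hW_h^n+\mathcal{L}_hW_h^n=0,\qquad n\ge1 .$$ Then the scheme is strongly stable: for every $n\ge1$, $$\|\mathcal{M}_h^{1/2}W_h^n\|_c\le\|\mathcal{M}_h^{1/2}W_h^{n-1}\|_c .$$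
   Context: For $[U,V]^T\in\mathbb{R}^N\times\mathbb{R}^N$, $\|[U,V]^T\|_c^2=c\|U\|^2+\|V\|^2$ with $\|\cdot\|$ the Euclidean norm. $\mathcal{M}_h^{1/2}$ is the symmetric positive definite square root of $\mathcal{M}_h$. ''Accounting for the essential boundary conditions'' means that the functions in $V_h$ vanish on $\partial\Omega$ in the Dirichlet case, are periodic in the periodic case (where $\Omega=(0,1)^k$), and are unconstrained in the Neumann case. The scheme discretizes the homogeneous system $u_t-\alpha(v-cu)+Lu=0$, $v_t+\alpha(v-cu)=0$, with $u$ and $v$ represented by nodal coefficient vectors $U_h^n,V_h^n$. *)

(* Defs.v *)
(* Library world: MathComp and MathComp-Analysis. *)
From HB Require Import structures.
From mathcomp Require Import all_boot all_order all_algebra complex.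
From mathcomp Require Import all_classical all_reals all_analysis.
Set Implicit Arguments.
Unset Strict Implicit.
Unset Printing Implicit Defensive.
Import Order.TTheory GRing.Theory Num.Theory.
Import numFieldNormedType.Exports.

Local Open Scope classical_set_scope.
Local Open Scope ring_scope.

(** * Lebesgue measure on R^k *)

Definition rV_display : measure_display.
Proof. exact: default_measure_display. Qed.

(* R^k is 'rV[R]_k, with the sigma-algebra generated by the coordinate maps,
   that is, the Borel sigma-algebra. *)
Section measurable_rV.
Context (R : realType) (k : nat).

Definition coord_preimages : set (set 'rV[R]_k) :=
  \bigcup_(j in [set: 'I_k])
    preimage_set_system [set: 'rV[R]_k] (fun x => x 0 j) measurable.

Definition measurable_rV : set (set 'rV[R]_k) := <<s coord_preimages >>.

Let measurable_rV0 : measurable_rV set0.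
Proof. exact: sigma_algebra0. Qed.

Let measurable_rVC A : measurable_rV A -> measurable_rV (~` A).
Proof. exact: sigma_algebraC. Qed.

Let measurable_rV_bigcup (F : (set _)^nat) : (forall i, measurable_rV (F i)) ->
  measurable_rV (\bigcup_i (F i)).
Proof. exact: sigma_algebra_bigcup. Qed.

HB.instance Definition _ := @isMeasurable.Build rV_display 'rV[R]_k
  measurable_rV measurable_rV0 measurable_rVC measurable_rV_bigcup.

Lemma measurable_coord (j : 'I_k) :
  measurable_fun [set: 'rV[R]_k] (fun x => x 0 j).
Proof. by move=> _ Y mY; apply: sub_sigma_algebra; exists j => //; exists Y. Qed.

Lemma measurable_fun_rV d (T : measurableType d) (f : T -> 'rV[R]_k) :
  (forall j, measurable_fun [set: T] (fun t => f t 0 j)) ->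
  measurable_fun [set: T] f.
Proof.
move=> mf.
have mS : @measurable _ ('rV[R]_k) = <<s coord_preimages >> by [].
apply: (measurability coord_preimages mS).
move=> _ [_ [j _ [B mB <-]] <-].
by have := mf j measurableT B mB; rewrite !setTI.
Qed.

End measurable_rV.

Section lebesgue_rV.
Context {R : realType}.

Definition consrv k (p : R * 'rV[R]_k) : 'rV[R]_k.+1 :=
  row_mx (p.1%:M : 'M[R]_1) p.2.

Lemma consrv0 k (p : R * 'rV[R]_k) : consrv p 0 ord0 = p.1.
Proof.
have -> : ord0 = lshift k (ord0 : 'I_1) by exact/val_inj.
by rewrite /consrv (row_mxEl (p.1%:M : 'M[R]_1)) mxE.
Qed.

Lemma consrvS k (p : R * 'rV[R]_k) j : consrv p 0 (lift ord0 j) = p.2 0 j.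
Proof.
have -> : lift ord0 j = rshift 1 j by exact/val_inj.
by rewrite /consrv (row_mxEr (p.1%:M : 'M[R]_1)).
Qed.

Lemma measurable_consrv k : measurable_fun [set: R * 'rV[R]_k] (@consrv k).
Proof.
apply: measurable_fun_rV => j; case: (unliftP ord0 j) => [i|] ->.
  under eq_fun do rewrite consrvS.
  exact: (measurableT_comp (measurable_coord i) measurable_snd).
by under eq_fun do rewrite consrv0; exact: measurable_fst.
Qed.

HB.instance Definition _ k :=
  isMeasurableFun.Build _ _ _ _ (@consrv k) (@measurable_consrv k).

Section succ.
Local Open Scope ereal_scope.
Variables (k : nat) (m : {sigma_finite_measure set 'rV[R]_k -> \bar R}).

(* The image on R^(k+1) of the product measure on R * R^k. *)
Definition lebesgue_rVS : set 'rV[R]_k.+1 -> \bar R :=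
  pushforward (@lebesgue_measure R \x m) (@consrv k).

Let lebesgue_rVS0 : lebesgue_rVS set0 = 0.
Proof. by rewrite /lebesgue_rVS /pushforward preimage_set0 measure0. Qed.

Let lebesgue_rVS_ge0 A : 0 <= lebesgue_rVS A.
Proof. by rewrite /lebesgue_rVS /pushforward; exact: measure_ge0. Qed.

Let lebesgue_rVS_sigma_additive : semi_sigma_additive lebesgue_rVS.
Proof.
by apply: measure_semi_sigma_additive; [exact: measurable_consrv|move=> ?..].
Qed.

HB.instance Definition _ := isMeasure.Build _ _ _ lebesgue_rVS
  lebesgue_rVS0 lebesgue_rVS_ge0 lebesgue_rVS_sigma_additive.

Let uncons (x : 'rV[R]_k.+1) : R * 'rV[R]_k := 
  (x 0%R ord0, \row_j x 0%R (lift ord0 j)).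

Let measurable_uncons : measurable_fun setT uncons.
Proof.
apply/measurable_fun_pair; first exact: measurable_coord.
by apply: measurable_fun_rV => j; under eq_fun do rewrite mxE; exact: measurable_coord.
Qed.

Let lebesgue_rVS_sigma_finite : sigma_finite setT lebesgue_rVS.
Proof.
have /sigma_finiteP[F [FT ndF Foo]] := sigma_finiteT (@lebesgue_measure R).
have /sigma_finiteP[G [GT ndG Goo]] := sigma_finiteT m.
exists (fun n => uncons @^-1` (F n `*` G n)).
  rewrite -preimage_bigcup; apply/esym; rewrite -subTset => x _.
  have [i _ Fi] : (\bigcup_i F i) (uncons x).1 by rewrite -FT.
  have [j _ Gj] : (\bigcup_i G i) (uncons x).2 by rewrite -GT.
  exists (maxn i j) => //; split.
    by move: Fi; exact/subsetPset/ndF/leq_maxl.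
  by move: Gj; exact/subsetPset/ndG/leq_maxr.
move=> n; have [mF ltF] := Foo n; have [mG ltG] := Goo n; split.
  rewrite -[_ @^-1` _]setTI.
  by apply: measurable_uncons => //; exact: measurableX.
rewrite /lebesgue_rVS /pushforward -comp_preimage.
rewrite (_ : uncons \o _ = id).
  by rewrite preimage_id product_measure1E// lte_mul_pinfty// ge0_fin_numE.
apply/funext => -[x v].
by rewrite /= /uncons consrv0; congr (_, _); apply/rowP => j; rewrite mxE consrvS.
Qed.

HB.instance Definition _ := Measure_isSigmaFinite.Build _ _ _ lebesgue_rVS
  lebesgue_rVS_sigma_finite.

End succ.

Fixpoint lebesgue_rV k : {sigma_finite_measure set 'rV[R]_k -> \bar R} :=
  match k with
  | 0 => \d_(0 : 'rV[R]_0)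
  | k.+1 => lebesgue_rVS (lebesgue_rV k)
  end.

Lemma lebesgue_rV_box k (a b : 'rV[R]_k) : (forall j, a 0 j <= b 0 j) ->
  lebesgue_rV k [set x | forall j, a 0 j <= x 0 j <= b 0 j] =
  (\prod_j (b 0 j - a 0 j))%:E.
Proof.
elim: k a b => [|k IH] a b ab.
  rewrite big_ord0 /= diracE mem_set//; by case.
pose a' : 'rV_k := \row_j a 0 (lift ord0 j).
pose b' : 'rV_k := \row_j b 0 (lift ord0 j).
have mbox : measurable [set x : 'rV[R]_k | forall j, a' 0 j <= x 0 j <= b' 0 j].
  rewrite (_ : mkset _ = \big[setI/setT]_j
      ((fun x : 'rV[R]_k => x 0 j) @^-1` `[a' 0 j, b' 0 j])).
    apply: bigsetI_measurable => j _; rewrite -[X in measurable X]setTI.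
    exact: measurable_coord.
  rewrite -bigcap_seq; apply/seteqP; split=> x /= xab j => [_|].
    by rewrite /= in_itv/=.
  by have := xab j; rewrite /= mem_index_enum in_itv/=; exact.
rewrite /= /lebesgue_rVS /pushforward.
rewrite (_ : _ @^-1` _ = `[a 0 ord0, b 0 ord0] `*`
    [set x : 'rV[R]_k | forall j, a' 0 j <= x 0 j <= b' 0 j]); last first.
  apply/seteqP; split=> -[x v] /=.
    move=> H; split; first by have := H ord0; rewrite consrv0/= in_itv.
    by move=> j; have := H (lift ord0 j); rewrite consrvS !mxE.
  rewrite in_itv/= => -[xab vab] j.
  case: (unliftP ord0 j) => [i|] ->; last by rewrite consrv0.
  by rewrite consrvS; have := vab i; rewrite !mxE.
rewrite product_measure1E// IH; last by move=> j; rewrite !mxE.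
rewrite big_ord_recl EFinM; congr (_ * _)%E.
  rewrite -[LHS]/(lebesgue_measure `[a 0 ord0, b 0 ord0]) lebesgue_measure_itv/=.
  rewrite lte_fin.
  have := ab ord0; rewrite le_eqVlt => /predU1P[->|->//].
  by rewrite ltxx subrr.
by congr EFin; apply: eq_bigr => j _; rewrite !mxE.
Qed.

End lebesgue_rV.

(** * Square root of a symmetric positive definite matrix *)

Section diagonalized.
Context (F : fieldType) (n : nat) (P : 'M[F]_n.+1).
Hypothesis Punit : P \in unitmx.

Lemma mulmx_diagonalized (e f : 'rV_n.+1) :
  invmx P *m diag_mx e *m P *m (invmx P *m diag_mx f *m P) =
  invmx P *m diag_mx (\row_j (e 0 j * f 0 j)) *m P.
Proof. by rewrite -mulmx_diag !mulmxA mulmxK. Qed.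

Lemma horner_mx_diagonalized (B : 'M[F]_n.+1) (e : 'rV_n.+1) (q : {poly F}) :
  B = invmx P *m diag_mx e *m P ->
  horner_mx B q = invmx P *m diag_mx (map_mx (horner q) e) *m P.
Proof. by move=> ->; rewrite horner_mx_uconjC// horner_mx_diag. Qed.

End diagonalized.

Section sqrtmx.
Context {R : rcfType}.

Definition posdefmx n (A : 'M[R]_n) : Prop :=
  A^T = A /\ forall x : 'cV[R]_n, x != 0 -> 0 < (x^T *m A *m x) 0 0.

Lemma posdefmx_ge0 n (A : 'M[R]_n) (x : 'cV_n) :
  posdefmx A -> 0 <= (x^T *m A *m x) 0 0.
Proof.
move=> [_ A0]; have [->|/A0/ltW//] := eqVneq x 0.
by rewrite mulmx0 mxE.
Qed.

Lemma sqrtmx_unique n (S S' : 'M[R]_n) :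
  posdefmx S -> posdefmx S' -> S *m S = S' *m S' -> S = S'.
Proof.
move=> pS pS' SS; set D := S - S'.
have DE : D^T *m S *m D = - (D^T *m D *m S').
  rewrite -!mulmxA -mulmxN; congr (_ *m _).
  by rewrite /D mulmxBl mulmxBr SS opprB.
have cE (M : 'M[R]_n) j : (D^T *m M *m D) j j =
    ((col j D)^T *m M *m col j D) 0 0.
  rewrite !mxE; apply: eq_bigr => i _; rewrite !mxE; congr (_ * _).
  by apply: eq_bigr => l _; rewrite !mxE.
have tr0 : \tr (D^T *m S *m D) = 0.
  apply/eqP; rewrite eq_le; apply/andP; split; last first.
    by apply: sumr_ge0 => j _; rewrite cE; exact: posdefmx_ge0.
  rewrite DE raddfN oppr_le0 /= -mulmxA mxtrace_mulC.
  apply: sumr_ge0 => j _.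
  have -> : (D *m S' *m D^T) j j = ((col j D^T)^T *m S' *m col j D^T) 0 0.
    rewrite !mxE; apply: eq_bigr => i _; rewrite !mxE; congr (_ * _).
    by apply: eq_bigr => l _; rewrite !mxE.
  exact: posdefmx_ge0.
apply/eqP; rewrite -subr_eq0 -/D; apply/eqP/matrixP => i j; rewrite mxE.
have /psumr_eq0P /(_ tr0 j isT) : forall j : 'I_n, true -> 0 <= (D^T *m S *m D) j j.
  by move=> l _; rewrite cE; exact: posdefmx_ge0.
rewrite cE; have [/matrixP/(_ i 0)|/(pS.2)/gt_eqF/eqP//] := eqVneq (col j D) 0.
by rewrite !mxE.
Qed.

Lemma interpolation (s : seq R) (f : R -> R) :
  exists q : {poly R}, forall x, x \in s -> q.[x] = f x.
Proof.
elim: s => [|a s [q qf]]; first by exists 0.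
have [ains|ains] := boolP (a \in s).
  by exists q => x; rewrite inE => /predU1P[->|]; exact: qf.
pose w := \prod_(b <- s) ('X - b%:P).
have w0 : w.[a] != 0 by rewrite -/(root w a) root_prod_XsubC.
exists (q + ((f a - q.[a]) / w.[a]) *: w) => x.
rewrite inE hornerD hornerZ => /predU1P[->|xs].
  by rewrite divfK// addrC subrK.
by have /rootP -> : root w x; rewrite ?root_prod_XsubC// mulr0 addr0 qf.
Qed.

Local Open Scope complex_scope.

Local Notation cmx := (map_mx (real_complex R)).

Lemma posdefmx_spectral n (A : 'M[R]_n) : posdefmx A ->
  exists (P : 'M[R[i]]_n) (d : 'rV[R]_n), [/\ P \in unitmx,
    forall j, 0 < d 0 j & cmx A = invmx P *m diag_mx (cmx d) *m P].
Proof.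
move=> [At A0]; pose B := cmx A.
have Bsym : B \is symmetricmx.
  by apply/is_hermitianmxP; rewrite expr0 scale1r map_mx_id// map_trmx At.
have Breal : B \is a mxOver Num.real.
  by apply/mxOverP => i j; rewrite mxE; apply/CrealP; exact: conjc_real.
have Bherm := realsym_hermsym Bsym Breal.
have [P [D [Punit PP Dreal BE]]] : exists (P : 'M[R[i]]_n) (D : 'rV_n),
    [/\ P \in unitmx, P *m map_mx Num.conj P^T = 1%:M,
    forall j, D 0 j = (complex.Re (D 0 j))%:C & B = invmx P *m diag_mx D *m P].
  have /orthomx_spectralP BE := symmetric_normalmx Bsym Breal.
  have /unitarymxP PP := spectral_unitarymx B.
  have DR := hermitian_spectral_diag_real Bherm.
  exists (spectralmx B), (spectral_diag B).
  split; [exact: spectral_unit|exact: PP| |exact: BE].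
  by move=> j; move/mxOverP : DR => /(_ 0 j)/RRe_real ->.
have PBP : P *m B *m (map_mx Num.conj P^T) = diag_mx D.
  by rewrite BE !mulmxA mulmxV// mul1mx -mulmxA PP mulmx1.
have DE : cmx (map_mx (@complex.Re R) D) = D.
  by apply/rowP => j; rewrite [RHS]Dreal mxE mxE.
exists P, (map_mx (@complex.Re R) D).
split; [exact: Punit| |by rewrite DE; exact: BE].
move=> j; rewrite mxE.
pose a := (map_mx (@complex.Re R) (row j P))^T.
pose b := (map_mx (@complex.Im R) (row j P))^T.
have -> : complex.Re (D 0 j) = (a^T *m A *m a) 0 0 + (b^T *m A *m b) 0 0.
  have -> : D 0 j = (P *m B *m (map_mx Num.conj P^T)) j j.
    by rewrite PBP mxE eqxx mulr1n.
  rewrite !mxE raddf_sum -big_split; apply: eq_bigr => l _ /=.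
  rewrite !mxE !mulr_suml raddf_sum -big_split; apply: eq_bigr => m _ /=.
  rewrite !mxE; case: (P j m) (P j l) => [x y] [z w] /=.
  by rewrite !mulr0 subr0 add0r mulrN opprK.
have [a0|an0] := eqVneq a 0; last first.
  by apply: ltr_pwDl; [exact: A0|exact: posdefmx_ge0].
rewrite ltr_wpDl//; first exact: posdefmx_ge0.
apply: A0; apply/eqP => b0.
have : row j P = 0.
  apply/rowP => l; move/matrixP : a0 => /(_ l 0); move/matrixP : b0 => /(_ l 0).
  by rewrite !mxE; case: (P j l) => x y /= -> ->.
move/(congr1 (mulmx^~ (invmx P))); rewrite -row_mul mulmxV// mul0mx.
by move=> /rowP/(_ j)/eqP; rewrite !mxE eqxx oner_eq0.
Qed.

Lemma trmx_horner n (A : 'M[R]_n.+1) q : A^T = A ->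
  (horner_mx A q)^T = horner_mx A q.
Proof.
move=> At; elim/poly_ind: q => [|p x ih]; first by rewrite rmorph0 trmx0.
rewrite rmorphD rmorphM/= horner_mx_X horner_mx_C raddfD/= tr_scalar_mx.
congr (_ + _).
rewrite -[_ * A]/(horner_mx A p *m A) trmx_mul ih At.
exact: (comm_mx_horner p (comm_mx_refl A)).
Qed.

Lemma sqrtmx_exists n (A : 'M[R]_n) : posdefmx A ->
  exists S, posdefmx S /\ S *m S = A.
Proof.
case: n A => [|n] A pA.
  exists 0; split; last by apply/matrixP => -[].
  by split=> [|x]; [rewrite trmx0|rewrite (flatmx0 x) eqxx].
have [P [d [Punit d0 AE]]] := posdefmx_spectral pA.
pose r x := Num.sqrt (Num.sqrt x) : R.
have [q qE] := interpolation [seq d 0 j | j <- enum 'I_n.+1] r.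
pose T := horner_mx A q.
have TT : T^T = T by exact: trmx_horner pA.1.
have dE : map_mx (horner (map_poly (real_complex R) q)) (cmx d) =
    map_mx (real_complex R) (map_mx r d).
  apply/rowP => j; rewrite [LHS]mxE [X in horner _ X]mxE [RHS]mxE [X in _ = _ X]mxE.
  by rewrite horner_map qE//; apply/mapP; exists j; rewrite ?mem_enum.
have TE : cmx T = invmx P *m diag_mx (cmx (map_mx r d)) *m P.
  rewrite -dE; apply: etrans (horner_mx_diagonalized Punit _ AE).
  exact: map_horner_mx.
have rK j : r (d 0 j) * r (d 0 j) * (r (d 0 j) * r (d 0 j)) = d 0 j.
  by rewrite -!expr2 !sqr_sqrtr ?sqrtr_ge0// ltW.
have T4 : T *m T *m (T *m T) = A.
  apply: (map_mx_inj (f := real_complex R)).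
  rewrite [LHS]map_mxM [X in X *m _]map_mxM [X in _ *m X]map_mxM TE AE.
  rewrite !(mulmx_diagonalized Punit).
  congr (invmx P *m diag_mx _ *m P).
  by apply/rowP => j; rewrite [RHS]mxE -rK !rmorphM !mxE.
move: T TT T4 {TE} => T TT T4.
have Aunit : A \in unitmx.
  rewrite -row_free_unit; apply/inj_row_free => v vA.
  apply/eqP; rewrite -[_ == 0](trmx_eq0 v); apply: contraT => v0.
  by have := pA.2 _ v0; rewrite trmxK vA mul0mx [X in _ < X]mxE ltxx.
exists (T *m T); split=> //; split; first by rewrite trmx_mul TT.
move=> x x0; have -> : x^T *m (T *m T) *m x = (T *m x)^T *m (T *m x).
  by rewrite trmx_mul TT !mulmxA.
rewrite mxE; under eq_bigr do rewrite mxE -expr2.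
rewrite lt0r sumr_ge0 ?andbT; last by move=> *; exact: sqr_ge0.
apply/eqP => /psumr_eq0P Tx; move/eqP : x0; apply.
have {}Tx : T *m x = 0.
  apply/colP => i; rewrite [RHS]mxE; apply/eqP; rewrite -sqrf_eq0; apply/eqP.
  by apply: Tx => // j _; exact: sqr_ge0.
apply: (can_inj (mulKmx Aunit)).
by rewrite mulmx0 -T4 -!mulmxA Tx !mulmx0.
Qed.

(* The symmetric positive definite square root; sqrtmx_wf and sqrtmx_unique
   show that it is well defined for symmetric positive definite A (otherwise
   it is 0). *)
Definition sqrtmx n (A : 'M[R]_n) : 'M[R]_n :=
  xget 0 [set S | posdefmx S /\ S *m S = A].

Lemma sqrtmx_wf n (A : 'M[R]_n) : posdefmx A ->
  posdefmx (sqrtmx A) /\ sqrtmx A *m sqrtmx A = A.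
Proof. by move=> /sqrtmx_exists[S SA]; apply: (@xgetPex _ 0 [set S | posdefmx S /\ S *m S = A]); exists S. Qed.

End sqrtmx.

(** * Sobolev space H^1 *)

Section sobolev.
Context {R : realType} {k : nat}.
Implicit Types (Omega : set 'rV[R]_k) (u : 'rV[R]_k -> R).

Local Notation e_ j := (delta_mx 0 j : 'rV[R]_k).

Definition iter_partial (s : seq 'I_k) u : 'rV[R]_k -> R :=
  foldr (fun j f x => 'D_(e_ j) f x) u s.

(* Infinitely differentiable: all iterated partial derivatives exist
   everywhere and are continuous. *)
Definition smooth u : Prop := forall s : seq 'I_k,
  continuous (iter_partial s u) /\
  forall j x, derivable (iter_partial s u) x (e_ j).

Definition test_function Omega u : Prop :=
  let support := closure [set x | u x != 0] in
  [/\ smooth u, compact support & support `<=` Omega].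

Definition L2 Omega u : Prop :=
  measurable_fun Omega u /\
  (\int[lebesgue_rV k]_(x in Omega) ((u x) ^+ 2)%:E < +oo)%E.

Definition is_weak_gradient Omega u (g : 'rV[R]_k -> 'rV[R]_k) : Prop :=
  forall j, L2 Omega (fun x => g x 0 j) /\
  forall psi, test_function Omega psi ->
    \int[lebesgue_rV k]_(x in Omega) (u x * 'D_(e_ j) psi x) =
    - \int[lebesgue_rV k]_(x in Omega) (g x 0 j * psi x).

Definition H1 Omega u : Prop :=
  L2 Omega u /\ exists g, is_weak_gradient Omega u g.

(* For u in H^1, a representative of the almost everywhere unique weak
   gradient. *)
Definition weak_gradient Omega u : 'rV[R]_k -> 'rV[R]_k :=
  xget (fun=> 0) [set g | is_weak_gradient Omega u g].

End sobolev.

(** * Domain, diffusion tensor, piecewise linear elements *)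

Inductive boundary_condition := Dirichlet | Neumann | Periodic.

Section finite_elements.
Context {R : realType} {k : nat}.
Implicit Types (Omega : set 'rV[R]_k) (v : 'rV[R]_k -> R).

Definition bounded_domain Omega : Prop :=
  [/\ open Omega, connected Omega, Omega !=set0 & bounded_set Omega].

Definition unit_cube : set 'rV[R]_k := [set x | forall j, 0 < x 0 j < 1].

Definition diffusion_tensor Omega (d : 'rV[R]_k -> 'M[R]_k) : Prop :=
  [/\ forall i j, measurable_fun Omega (fun x => d x i j),
      exists C : R, forall x, Omega x -> forall i j, `|d x i j| <= C,
      forall x, Omega x -> (d x)^T = d x &
      exists2 delta : R, 0 < delta & forall x, Omega x -> forall xi : 'rV[R]_k,
        delta * (xi *m xi^T) 0 0 <= (xi *m d x *m xi^T) 0 0].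

(* Each element is a closed set carrying k+1 affinely independent vertices, at
   which an affine function is determined. For the usual straight mesh each
   element is the simplex spanned by its vertices; elements with curved faces
   are allowed, so that Omega need not be a polytope. *)
Record mesh Omega := Mesh {
  mesh_size : nat;
  element : 'I_mesh_size -> set 'rV[R]_k;
  vertex : 'I_mesh_size -> 'I_k.+1 -> 'rV[R]_k;
  element_closed : forall e, closed (element e);
  vertex_element : forall e l, element e (vertex e l);
  vertex_affine_free : forall e,
    row_free (\matrix_l (vertex e (lift ord0 l) - vertex e ord0));
  element_cover : \bigcup_(e in [set: 'I_mesh_size]) element e = closure Omega;
  element_disjoint : forall e f, e != f ->
    interior (element e) `&` interior (element f) = set0
}.
Arguments element {Omega} m e.
Arguments vertex {Omega} m e l.

Definition affine_on (A : set 'rV[R]_k) v : Prop :=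
  exists (a : 'cV[R]_k) (b : R), forall x, A x -> v x = (x *m a) 0 0 + b.

Definition essential_condition (bc : boundary_condition) Omega v : Prop :=
  match bc with
  | Dirichlet => forall x, (closure Omega `\` interior Omega) x -> v x = 0
  | Neumann => True
  | Periodic => forall x y, closure Omega x -> closure Omega y ->
      (forall j, x 0 j - y 0 j \is a Num.int) -> v x = v y
  end.

(* Only the restriction of v to the closure of Omega is meaningful. *)
Definition fe_space (bc : boundary_condition) Omega (T : mesh Omega) :
    set ('rV[R]_k -> R) :=
  [set v | [/\ {within closure Omega, continuous v},
               forall e, affine_on (element T e) v &
               essential_condition bc Omega v]].

Definition nodal_basis (bc : boundary_condition) Omega (T : mesh Omega) N
    (node : 'I_N -> 'rV[R]_k) (phi : 'I_N -> 'rV[R]_k -> R) : Prop :=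
  [/\ forall i, exists e l, node i = vertex T e l,
      forall i, fe_space bc T (phi i),
      forall i j, phi i (node j) = (i == j)%:R &
      forall v, fe_space bc T v ->
        forall x, closure Omega x -> v x = \sum_i v (node i) * phi i x].

Definition mass_matrix Omega N (phi : 'I_N -> 'rV[R]_k -> R) : 'M[R]_N :=
  \matrix_(i, j) \int[lebesgue_rV k]_(x in Omega) (phi j x * phi i x).

Definition stiffness_matrix Omega (d : 'rV[R]_k -> 'M[R]_k) N
    (phi : 'I_N -> 'rV[R]_k -> R) : 'M[R]_N :=
  \matrix_(i, j) \int[lebesgue_rV k]_(x in Omega)
    ((d x *m (weak_gradient Omega (phi j) x)^T)^T
       *m (weak_gradient Omega (phi i) x)^T) 0 0.

End finite_elements.

(** * The fully implicit scheme *)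

Section scheme.
Context {R : realType} {N : nat}.

Definition block_mass (M : 'M[R]_N) : 'M[R]_(N + N) := block_mx M 0 0 M.

Definition block_stiffness (L : 'M[R]_N) : 'M[R]_(N + N) := block_mx L 0 0 0.

Definition coupling (alpha c : R) : 'M[R]_(N + N) :=
  alpha *: block_mx c%:M (- 1%:M) (- c%:M) 1%:M.

Definition fully_implicit (alpha c tau : R) (M L : 'M[R]_N)
    (W : nat -> 'cV[R]_(N + N)) : Prop :=
  forall n, (1 <= n)%N ->
    tau^-1 *: (block_mass M *m (W n - W n.-1))
      + coupling alpha c *m block_mass M *m W n
      + block_stiffness L *m W n = 0.

Definition enorm n (x : 'cV[R]_n) : R := Num.sqrt (\sum_i x i 0 ^+ 2).

Definition cnorm (c : R) (W : 'cV[R]_(N + N)) : R :=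
  Num.sqrt (c * enorm (usubmx W) ^+ 2 + enorm (dsubmx W) ^+ 2).

End scheme.

(* Main.v *)
Require Import Defs.
From mathcomp Require Import all_boot all_order all_algebra.
From mathcomp Require Import all_classical all_reals all_analysis.
From mathcomp Require Import measurable_realfun ring lra.
Import Order.TTheory GRing.Theory Num.Theory.
Import numFieldNormedType.Exports.
Local Open Scope classical_set_scope.
Local Open Scope ring_scope.

Set Implicit Arguments.
Unset Strict Implicit.
Unset Printing Implicit Defensive.

(** Strong stability is the discrete energy estimate obtained by testing the
    scheme at step [n] with [(c U, V)], where [W n = (U, V)] and
    [W n.-1 = (U', V')].  Writing [b] for the bilinear form of the mass matrix
    [M] and [l] for that of the stiffness matrix [L], the two block rows of the
    scheme, tested with [c U] and [V], add up to

      [1/tau * (c b(U, U - U') + b(V, V - V'))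
         + alpha b(cU - V, cU - V) + c l(U, U) = 0].

    The weight [c] in the norm is exactly what turns the two reaction terms
    into the square [b(cU - V, cU - V)].  As [M] and [L] are positive
    semidefinite, the last two summands are nonnegative, so that
    [c b(U, U) + b(V, V) <= c b(U, U') + b(V, V')], and
    [2 b(x, y) <= b(x, x) + b(y, y)] absorbs the old values on the right
    ([implicit_step_energy]).  By uniqueness of the positive definite square
    root, the square root of the block diagonal mass matrix is block diagonal,
    hence the square of the norm in the theorem is [c b(U, U) + b(V, V)]
    ([cnorm_sqrtmx]).

    The analytic part is that the assembled matrices have these signs.  Both
    are matrices of integrals, and their quadratic forms are integrals of
    pointwise quadratic forms ([bform_Rintegral]) once all entries are
    integrable, which follows from square integrability of the basis functions
    and of their weak gradients and from boundedness of the diffusion tensor.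
    For [L] the integrand is nonnegative because the tensor is
    ([stiffness_matrix_psd]).  For [M] it is [v ^+ 2], where [v] is the finite
    element function with nodal values [x]; if [x != 0] then [v] is nonzero at
    some node, hence by continuity bounded away from [0] on a nonempty open
    subset of the domain, and such a set has positive Lebesgue measure
    ([mass_matrix_posdef]).  Positive definiteness, not only semidefiniteness,
    of [M] is what makes its square root meaningful. *)

(** * Bilinear forms and square roots of block matrices *)

Section bilinear_form.
Context {R : comPzRingType} {n : nat}.
Implicit Types (A : 'M[R]_n) (x y z : 'cV[R]_n) (a : R).

Definition bform A x y : R := (x^T *m A *m y) 0 0.

Lemma bformE A x y : bform A x y = \sum_i \sum_j x i 0 * A i j * y j 0.
Proof.
rewrite /bform mxE exchange_big/=; apply: eq_bigr => j _.
by rewrite mxE mulr_suml; apply: eq_bigr => i _; rewrite mxE.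
Qed.

Lemma bformBr A x y z : bform A x (y - z) = bform A x y - bform A x z.
Proof. by rewrite /bform mulmxBr !mxE. Qed.

Lemma bformZr A a x y : bform A x (a *: y) = a * bform A x y.
Proof. by rewrite /bform -scalemxAr mxE. Qed.

Lemma bform_sym A x y : A^T = A -> bform A x y = bform A y x.
Proof.
move=> At; rewrite /bform.
have -> : y^T *m A *m x = (x^T *m A *m y)^T by rewrite !trmx_mul trmxK At mulmxA.
by rewrite [RHS]mxE.
Qed.

End bilinear_form.

Section square_root.
Context {R : realType}.

Lemma mul_block_mass n (A B : 'M[R]_n) :
  block_mass A *m block_mass B = block_mass (A *m B).
Proof. by rewrite /block_mass mulmx_block !mulmx0 !mul0mx !addr0 !add0r. Qed.

Lemma posdefmx_block_mass n (A : 'M[R]_n) : posdefmx A -> posdefmx (block_mass A).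
Proof.
move=> pA; split; first by rewrite /block_mass tr_block_mx !trmx0 pA.1.
move=> x; rewrite -[x]vsubmxK; move: (usubmx x) (dsubmx x) => u v uv0.
have -> : ((col_mx u v)^T *m block_mass A *m col_mx u v) 0 0 =
    (u^T *m A *m u) 0 0 + (v^T *m A *m v) 0 0.
  rewrite tr_col_mx /block_mass mul_row_block !mulmx0 addr0 add0r.
  by rewrite mul_row_col [LHS]mxE.
have [u0|/pA.2 u0] := eqVneq u 0; last by rewrite ltr_pwDl// posdefmx_ge0.
rewrite ltr_wpDl ?posdefmx_ge0//; apply: pA.2; apply: contraNneq uv0 => ->.
by rewrite u0 col_mx0.
Qed.

(** The block diagonal matrix of the roots is a positive definite square root,
    and there is only one. *)
Lemma sqrtmx_block_mass n (A : 'M[R]_n) : posdefmx A ->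
  sqrtmx (block_mass A) = block_mass (sqrtmx A).
Proof.
move=> pA; have [pS SS] := sqrtmx_wf pA.
have [pT TT] := sqrtmx_wf (posdefmx_block_mass pA).
apply: sqrtmx_unique => //; first exact: posdefmx_block_mass.
by rewrite mul_block_mass SS.
Qed.

End square_root.

(** * The energy estimate for one implicit step *)

Section scheme.
Context {R : realType} {N : nat}.

Lemma enorm_sqrtmx (A : 'M[R]_N) (x : 'cV[R]_N) : posdefmx A ->
  enorm (sqrtmx A *m x) ^+ 2 = bform A x x.
Proof.
move=> pA; have [[St _] SS] := sqrtmx_wf pA.
rewrite /enorm sqr_sqrtr ?sumr_ge0// => [|i _]; last exact: sqr_ge0.
have -> : bform A x x = ((sqrtmx A *m x)^T *m (sqrtmx A *m x)) 0 0.
  by rewrite trmx_mul St !mulmxA -[x^T *m _ *m _]mulmxA SS.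
by rewrite mxE; apply: eq_bigr => i _; rewrite [in RHS]mxE expr2.
Qed.

(** This removes square roots of matrices from the statement: only the quadratic
    form of [A] itself remains. *)
Lemma cnorm_sqrtmx (c : R) (A : 'M[R]_N) (x : 'cV[R]_(N + N)) : posdefmx A ->
  cnorm c (sqrtmx (block_mass A) *m x) =
  Num.sqrt (c * bform A (usubmx x) (usubmx x) + bform A (dsubmx x) (dsubmx x)).
Proof.
move=> pA; rewrite /cnorm sqrtmx_block_mass//.
rewrite -[X in _ *m X]vsubmxK /block_mass mul_block_col !mul0mx addr0 add0r.
by rewrite col_mxKu col_mxKd !enorm_sqrtmx.
Qed.

(** The reaction enters both block rows through the same vector
    [M (c U - V)], with opposite signs. *)
Lemma implicit_step_components (alpha c tau : R) (M L : 'M[R]_N)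
    (W W' : 'cV[R]_(N + N)) :
  tau^-1 *: (block_mass M *m (W - W')) + coupling alpha c *m block_mass M *m W
    + block_stiffness L *m W = 0 ->
  let U := usubmx W in let V := dsubmx W in
  tau^-1 *: (M *m (U - usubmx W')) + alpha *: (M *m (c *: U - V)) + L *m U = 0
  /\ tau^-1 *: (M *m (V - dsubmx W')) - alpha *: (M *m (c *: U - V)) = 0.
Proof.
rewrite -[W]vsubmxK -[W']vsubmxK !col_mxKu !col_mxKd.
move: (usubmx W) (dsubmx W) (usubmx W') (dsubmx W') => U V U' V' /=.
rewrite -mulmxA /coupling -scalemxAl /block_mass /block_stiffness.
rewrite opp_col_mx add_col_mx !mul_block_col !mul0mx !addr0 !add0r.
rewrite !scale_col_mx !add_col_mx -(@col_mx0 _ N N 1) => /eq_col_mx[eU eV].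
split.
  rewrite -[RHS]eU; congr (_ + _ *: _ + _).
  by rewrite mulmxBr -scalemxAr mulNmx !mul_scalar_mx scale1r.
rewrite -[RHS]eV addr0 -scalerN; congr (_ + _ *: _).
by rewrite mulmxBr -scalemxAr mulNmx !mul_scalar_mx scale1r opprB addrC.
Qed.

(** Implicitness is used here: the reaction and diffusion terms are tested with
    the new values at which they are evaluated, hence they dissipate energy
    for every step size. *)
Lemma implicit_step_energy (alpha c tau : R) (M L : 'M[R]_N)
    (U V U' V' : 'cV[R]_N) :
  0 < alpha -> 0 < c -> 0 < tau -> posdefmx M -> (forall x, 0 <= bform L x x) ->
  tau^-1 *: (M *m (U - U')) + alpha *: (M *m (c *: U - V)) + L *m U = 0 ->
  tau^-1 *: (M *m (V - V')) - alpha *: (M *m (c *: U - V)) = 0 ->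
  c * bform M U U + bform M V V <= c * bform M U' U' + bform M V' V'.
Proof.
move=> alpha0 c0 tau0 pM L0 eU eV.
have M0 x : 0 <= bform M x x by exact: posdefmx_ge0.
have symM x y : bform M x y = bform M y x by exact: bform_sym pM.1.
have {}eU : tau^-1 * bform M U (U - U') + alpha * bform M U (c *: U - V)
    + bform L U U = 0.
  move: (U - U') (c *: U - V) eU => x y /(congr1 (fun r => (U^T *m r) 0 0)).
  by rewrite /bform /= !mulmxDr -!scalemxAr !mulmxA !mulmx0 !mxE.
have {}eV : tau^-1 * bform M V (V - V') - alpha * bform M V (c *: U - V) = 0.
  move: (V - V') (c *: U - V) eV => x y /(congr1 (fun r => (V^T *m r) 0 0)).
  by rewrite /bform /= mulmxDr mulmxN -!scalemxAr !mulmxA !mulmx0 !mxE.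
(* The weights [c] and [1] of the two tested rows complete the square. *)
have dissip : bform M (c *: U - V) (c *: U - V) =
    c * bform M U (c *: U - V) - bform M V (c *: U - V).
  by rewrite symM bformBr bformZr !(symM (c *: U - V)).
have young x y : 2 * bform M x y <= bform M x x + bform M y y.
  have := M0 (x - y); rewrite bformBr !(symM (x - y)) !bformBr (symM y x).
  by lra.
have step : tau^-1 * (c * bform M U (U - U') + bform M V (V - V')) <= 0.
  have := mulr_ge0 (ltW alpha0) (M0 (c *: U - V)).
  have := mulr_ge0 (ltW c0) (L0 U).
  by rewrite dissip; nra.
have {}step : c * bform M U (U - U') + bform M V (V - V') <= 0.
  by rewrite pmulr_rle0 ?invr_gt0 in step.
rewrite !bformBr in step.
have := ler_wpM2l (ltW c0) (young U U').
have := young V V'.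
by lra.
Qed.

End scheme.

(** * Open sets of R^k: measurability and positive Lebesgue measure *)

Section boxes.
Context {R : realType} {k : nat}.

(** Rational corners make the family of boxes countable. *)
Definition rat_box (ab : 'rV[rat]_k * 'rV[rat]_k) : set 'rV[R]_k :=
  [set x | forall j, ratr (ab.1 0 j) <= x 0 j <= ratr (ab.2 0 j)].

Lemma measurable_rat_box ab : measurable (rat_box ab).
Proof.
rewrite (_ : rat_box ab = \big[setI/setT]_j
    ((fun x : 'rV[R]_k => x 0 j) @^-1` `[ratr (ab.1 0 j), ratr (ab.2 0 j)])).
  apply: bigsetI_measurable => j _; rewrite -[X in measurable X]setTI.
  exact: measurable_coord.
rewrite -bigcap_seq; apply/seteqP; split=> x /= xab j => [_|].
  by rewrite /= in_itv/=.
by have := xab j; rewrite /= mem_index_enum in_itv/=; exact.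
Qed.

Lemma open_rat_box (O : set 'rV[R]_k) x : open O -> O x ->
  exists2 ab, rat_box ab `<=` O &
    forall j, ratr (ab.1 0 j) < x 0 j < ratr (ab.2 0 j).
Proof.
move=> oO Ox; have : nbhs x O by exact: open_nbhs_nbhs.
rewrite -nbhs_ballE => -[e /= e0 eO].
have /choice[a aP] (j : 'I_k) : exists a, x 0 j - e < (ratr a : R) < x 0 j.
  have /rat_in_itvoo[a] : x 0 j - e < x 0 j by rewrite gtrBl.
  by rewrite in_itv/=; exists a.
have /choice[b bP] (j : 'I_k) : exists b, x 0 j < (ratr b : R) < x 0 j + e.
  have /rat_in_itvoo[b] : x 0 j < x 0 j + e by rewrite ltrDl.
  by rewrite in_itv/=; exists b.
exists (\row_j a j, \row_j b j) => [y /= yab|j]; last first.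
  by rewrite !mxE; case/andP : (aP j) => _ ->; case/andP : (bP j) => ->.
apply: eO; split=> // i j; rewrite !ord1 /ball/= ltr_norml.
have := yab j; rewrite !mxE => /andP[ay yb].
by case/andP : (aP j) => a1 _; case/andP : (bP j) => _ b1; lra.
Qed.

(** The sigma-algebra on R^k is generated by the coordinates rather than by the
    topology; an open set belongs to it as the union of the countably many
    rational boxes that it contains. *)
Lemma open_measurable_rV (O : set 'rV[R]_k) : open O -> measurable O.
Proof.
move=> oO; pose F ab := if `[< rat_box ab `<=` O >] then rat_box ab else set0.
rewrite (_ : O = \bigcup_ab F ab).
  apply: countable_bigcupT_measurable; first exact: countableP.
  by move=> ab; rewrite /F; case: ifP => // _; exact: measurable_rat_box.
apply/seteqP; split=> [x Ox|x [ab _]]; last first.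
  by rewrite /F; case: ifPn => // /asboolP; exact.
have [ab abO xab] := open_rat_box oO Ox; exists ab => //.
rewrite /F; case: ifPn => [_ j|/asboolP//].
by case/andP : (xab j) => /ltW -> /ltW ->.
Qed.

(** A nonempty open set contains a nondegenerate box, whose volume is known. *)
Lemma open_lebesgue_rV_gt0 (O : set 'rV[R]_k) : open O -> O !=set0 ->
  (0 < lebesgue_rV k O)%E.
Proof.
move=> oO [x Ox]; have [ab abO xab] := open_rat_box oO Ox.
have ablt j : ratr (ab.1 0 j) < ratr (ab.2 0 j) :> R.
  by case/andP : (xab j); exact: lt_trans.
apply: (@lt_le_trans _ _ (lebesgue_rV k (rat_box ab))); last first.
  by apply: le_measure => //; rewrite inE;
    [exact: measurable_rat_box|exact: open_measurable_rV].
pose a : 'rV[R]_k := map_mx ratr ab.1; pose b : 'rV[R]_k := map_mx ratr ab.2.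
have -> : rat_box ab = [set y | forall j, a 0 j <= y 0 j <= b 0 j].
  by apply/seteqP; split=> y yab j; have := yab j; rewrite !mxE.
rewrite lebesgue_rV_box => [|j]; last by rewrite !mxE ltW.
by rewrite lte_fin prodr_gt0// => j _; rewrite !mxE subr_gt0.
Qed.

End boxes.

(** * Quadratic forms of matrices of integrals *)

Section Rintegral_matrix.
Context d (T : measurableType d) (R : realType).
Variables (mu : {measure set T -> \bar R}) (D : set T).
Hypothesis mD : measurable D.

Lemma integrable_sumR I (s : seq I) (f : I -> T -> R) :
  (forall i, mu.-integrable D (EFin \o f i)) ->
  mu.-integrable D (EFin \o fun t => \sum_(i <- s) f i t).
Proof.
move=> fi; rewrite (_ : _ \o _ = fun t => (\sum_(i <- s) (f i t)%:E)%E).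
  by apply: integrable_sum => // i _; exact: fi.
by apply/funext => t /=; rewrite sumEFin.
Qed.

Lemma Rintegral_sum I (s : seq I) (f : I -> T -> R) :
  (forall i, mu.-integrable D (EFin \o f i)) ->
  \int[mu]_(t in D) (\sum_(i <- s) f i t) = \sum_(i <- s) \int[mu]_(t in D) f i t.
Proof.
move=> fi; elim: s => [|i s IH].
  rewrite big_nil; under eq_Rintegral do rewrite big_nil.
  by rewrite Rintegral_cst// mul0r.
rewrite big_cons; under eq_Rintegral do rewrite big_cons.
by rewrite RintegralD// ?IH//; exact: integrable_sumR.
Qed.

Lemma integrableZR (a : R) (f : T -> R) : mu.-integrable D (EFin \o f) ->
  mu.-integrable D (EFin \o fun t => a * f t).
Proof.
by move=> fi; rewrite (_ : _ \o _ = fun t => (a%:E * (f t)%:E)%E) //;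
  exact: integrableZl.
Qed.

Lemma integrable_bform N (A : 'I_N -> 'I_N -> T -> R) (x : 'cV[R]_N) :
  (forall i j, mu.-integrable D (EFin \o A i j)) ->
  mu.-integrable D (EFin \o fun t => bform (\matrix_(i, j) A i j t) x x).
Proof.
move=> Ai.
under eq_fun do rewrite bformE.
apply: integrable_sumR => i; apply: integrable_sumR => j.
rewrite (_ : (fun t => _) = fun t => (x i 0 * x j 0) * A i j t).
  exact: integrableZR.
by apply/funext => t; rewrite mxE mulrAC.
Qed.

(** Reduces the sign of an assembled matrix to a pointwise sign. Integrability
    of every entry matters: the integral of a nonintegrable function is a junk
    value, which would break linearity. *)
Lemma bform_Rintegral N (A : 'I_N -> 'I_N -> T -> R) (x : 'cV[R]_N) :
  (forall i j, mu.-integrable D (EFin \o A i j)) ->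
  bform (\matrix_(i, j) \int[mu]_(t in D) A i j t) x x =
  \int[mu]_(t in D) bform (\matrix_(i, j) A i j t) x x.
Proof.
move=> Ai; rewrite bformE.
pose B i j t := (x i 0 * x j 0) * A i j t.
have Bi i j : mu.-integrable D (EFin \o B i j) by exact: integrableZR.
transitivity (\int[mu]_(t in D) \sum_i \sum_j B i j t).
  rewrite Rintegral_sum => [|i]; last exact: integrable_sumR.
  apply: eq_bigr => i _; rewrite Rintegral_sum//; apply: eq_bigr => j _.
  by rewrite RintegralZl// mxE mulrAC.
apply: eq_Rintegral => t _; rewrite bformE.
by apply: eq_bigr => i _; apply: eq_bigr => j _; rewrite mxE mulrAC.
Qed.

Lemma Rintegral_gt0 (f : T -> R) (E : set T) (e : R) :
  mu.-integrable D (EFin \o f) -> (forall t, D t -> 0 <= f t) ->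
  measurable E -> E `<=` D -> (0 < mu E)%E -> 0 < e ->
  (forall t, E t -> e <= f t) ->
  0 < \int[mu]_(t in D) f t.
Proof.
move=> fi f0 mE ED muE e0 ef.
rewrite -lte_fin /Rintegral fineK; last exact: integrable_fin_num.
apply: (@lt_le_trans _ _ (e%:E * mu E)%E); first by rewrite mule_gt0.
have mf : measurable_fun D f by apply/measurable_EFinP; exact: measurable_int fi.
rewrite -integral_cst//.
apply: (@le_trans _ _ (\int[mu]_(t in E) (f t)%:E)%E).
  apply: ge0_le_integral => //.
  - by move=> t _; rewrite lee_fin ltW.
  - by apply/measurable_EFinP; exact: (measurable_funS mD ED mf).
by apply: ge0_subset_integral => //; exact/measurable_EFinP.
Qed.

End Rintegral_matrix.

(** * The stiffness and mass matrices *)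

Section finite_element_matrices.
Context {R : realType} {k : nat}.
Variable Omega : set 'rV[R]_k.
Hypothesis oOmega : open Omega.

Let mOmega : measurable Omega. Proof. exact: open_measurable_rV. Qed.

(** Domination by an integrable function: [|u v| <= u^2 + v^2]. *)
Lemma L2_mul_integrable (u v : 'rV[R]_k -> R) : L2 Omega u -> L2 Omega v ->
  (lebesgue_rV k).-integrable Omega (EFin \o fun x => u x * v x).
Proof.
move=> [mu u2] [mv v2].
have sqr_int (w : 'rV[R]_k -> R) : measurable_fun Omega w ->
    (\int[lebesgue_rV k]_(x in Omega) (w x ^+ 2)%:E < +oo)%E ->
    (lebesgue_rV k).-integrable Omega (EFin \o fun x => w x ^+ 2).
  move=> mw w2; apply/integrableP; split.
    by apply/measurable_EFinP; exact: measurable_funX.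
  by under eq_integral do rewrite /= ger0_norm ?sqr_ge0//.
have := integrableD mOmega (sqr_int u mu u2) (sqr_int v mv v2).
apply: le_integrable => //.
  by apply/measurable_EFinP; exact: measurable_funM.
move=> x _; rewrite /= lee_fin [leRHS]ger0_norm ?addr_ge0 ?sqr_ge0// ler_norml.
have := sqr_ge0 (u x - v x); have := sqr_ge0 (u x + v x).
by have := sqr_ge0 (u x); have := sqr_ge0 (v x); nra.
Qed.

(** Each of the [k ^ 2] terms of the pairing is a product of two [L2] functions
    times an entry of [d], which is bounded. *)
Lemma diffusion_pairing_integrable (d : 'rV[R]_k -> 'M[R]_k)
    (g h : 'rV[R]_k -> 'rV[R]_k) :
  diffusion_tensor Omega d ->
  (forall j, L2 Omega (fun x => g x 0 j)) ->
  (forall j, L2 Omega (fun x => h x 0 j)) ->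
  (lebesgue_rV k).-integrable Omega
    (EFin \o fun x => ((d x *m (g x)^T)^T *m (h x)^T) 0 0).
Proof.
move=> [md [C dC] _ _] g2 h2.
rewrite (_ : (fun x => _) =
    fun x => \sum_a \sum_b d x a b * (g x 0 b * h x 0 a)).
  apply: integrable_sumR => // a; apply: integrable_sumR => // b.
  have gh := L2_mul_integrable (g2 b) (h2 a).
  apply: le_integrable (integrableZR mOmega C gh) => //.
    apply/measurable_EFinP; apply: measurable_funM => //.
    by apply/measurable_EFinP; exact: measurable_int gh.
  move=> x Ox; rewrite /= lee_fin !normrM ler_wpM2r ?mulr_ge0//.
  by rewrite (le_trans (dC x Ox a b))// ler_norm.
apply/funext => x; rewrite mxE; apply: eq_bigr => a _.
rewrite !mxE mulr_suml; apply: eq_bigr => b _.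
by rewrite !mxE mulrA.
Qed.

Lemma H1_L2_weak_gradient u j : H1 Omega u ->
  L2 Omega (fun x => weak_gradient Omega u x 0 j).
Proof.
move=> [_ [g ug]].
by have /(_ j)[] := @xgetPex _ (fun=> 0) [set g | is_weak_gradient Omega u g]
  (ex_intro _ g ug).
Qed.

(** At each point [t] the integrand is the quadratic form of [d t] at the
    gradient of the combination of the [phi i] with coefficients [x]. The
    bound is only semidefinite: under Neumann or periodic conditions constants
    lie in the kernel. *)
Lemma stiffness_matrix_psd (d : 'rV[R]_k -> 'M[R]_k) N
    (phi : 'I_N -> 'rV[R]_k -> R) (x : 'cV[R]_N) :
  diffusion_tensor Omega d -> (forall i, H1 Omega (phi i)) ->
  0 <= bform (stiffness_matrix Omega d phi) x x.
Proof.
move=> dd phi1; rewrite /stiffness_matrix bform_Rintegral//; last first.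
  by move=> i j; apply: diffusion_pairing_integrable => // a;
    exact: H1_L2_weak_gradient.
apply: Rintegral_ge0 => t Ot.
(* The rows of [G] are the gradients, so [x^T *m G] is the gradient of the
   combination. *)
pose G := \matrix_i weak_gradient Omega (phi i) t.
have -> : bform (\matrix_(i, j) ((d t *m (weak_gradient Omega (phi j) t)^T)^T
    *m (weak_gradient Omega (phi i) t)^T) 0 0) x x =
    ((x^T *m G) *m d t *m (x^T *m G)^T) 0 0.
  have [_ _ /(_ t Ot) dT _] := dd.
  rewrite /bform (_ : \matrix_(i, j) _ = G *m d t *m G^T).
    by rewrite trmx_mul trmxK !mulmxA.
  have GdGt : (G *m d t *m G^T)^T = G *m d t *m G^T.
    by rewrite !trmx_mul trmxK dT mulmxA.
  rewrite -GdGt; apply/matrixP => i j; rewrite [LHS]mxE [RHS]mxE trmx_mul trmxK dT.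
  rewrite -(rowK (fun i => weak_gradient Omega (phi i) t) i).
  rewrite -(rowK (fun i => weak_gradient Omega (phi i) t) j) -/G.
  by rewrite -row_mul tr_row [RHS]mxE [LHS]mxE; apply: eq_bigr => l _; rewrite !mxE.
have [_ _ _ [delta delta0 /(_ t Ot)/(_ (x^T *m G))]] := dd.
apply: le_trans; rewrite mulr_ge0 ?(ltW delta0)// mxE sumr_ge0// => i _.
by rewrite [X in _ * X]mxE -expr2 sqr_ge0.
Qed.

Lemma mass_matrix_sym N (phi : 'I_N -> 'rV[R]_k -> R) :
  (mass_matrix Omega phi)^T = mass_matrix Omega phi.
Proof.
apply/matrixP => i j; rewrite !mxE.
by apply: eq_Rintegral => x _; rewrite mulrC.
Qed.

Lemma sqr_lincombE N (phi : 'I_N -> 'rV[R]_k -> R) (x : 'cV[R]_N) t :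
  (\sum_i x i 0 * phi i t) ^+ 2 = bform (\matrix_(i, j) (phi j t * phi i t)) x x.
Proof.
rewrite bformE expr2 big_distrlr /=.
by apply: eq_bigr => i _; apply: eq_bigr => j _; rewrite mxE; ring.
Qed.

Lemma sqr_lincomb_integrable N (phi : 'I_N -> 'rV[R]_k -> R) (x : 'cV[R]_N) :
  (forall i, L2 Omega (phi i)) -> (lebesgue_rV k).-integrable Omega
    (EFin \o fun t => (\sum_i x i 0 * phi i t) ^+ 2).
Proof.
move=> phi2; under [fun t => _ ^+ 2]eq_fun do rewrite sqr_lincombE.
by apply: integrable_bform => // i j; exact: L2_mul_integrable.
Qed.

Lemma bform_mass_matrix N (phi : 'I_N -> 'rV[R]_k -> R) (x : 'cV[R]_N) :
  (forall i, L2 Omega (phi i)) ->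
  bform (mass_matrix Omega phi) x x =
  \int[lebesgue_rV k]_(t in Omega) (\sum_i x i 0 * phi i t) ^+ 2.
Proof.
move=> phi2; rewrite /mass_matrix bform_Rintegral//; last first.
  by move=> i j; exact: L2_mul_integrable.
by apply: eq_Rintegral => t _; rewrite sqr_lincombE.
Qed.

(** The point [z] may lie on the boundary, where continuity holds only from
    inside the closure; every neighbourhood of [z] still meets the open set
    [Omega] in a nonempty open set. *)
Lemma Rintegral_sqr_gt0 (v : 'rV[R]_k -> R) z :
  {within closure Omega, continuous v} -> closure Omega z -> v z != 0 ->
  (lebesgue_rV k).-integrable Omega (EFin \o fun x => v x ^+ 2) ->
  0 < \int[lebesgue_rV k]_(x in Omega) v x ^+ 2.
Proof.
move=> /subspace_continuousP vcont zO vz vint.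
have vz2 : `|v z| / 2 < `|v z| by rewrite ltr_pdivrMr// ltr_pMr ?normr_gt0// ltr1n.
have : \forall t \near within (closure Omega) (nbhs z), `|v z| / 2 < `|v t|.
  by apply: (cvgr_norm_gt (v z)) vz2; exact: vcont.
rewrite near_withinE => near_z.
pose O := Omega `&` interior [set y | closure Omega y -> `|v z| / 2 < `|v y|].
have oO : open O by apply: openI => //; exact: open_interior.
have OO : O !=set0 by apply: zO; exact: nbhs_interior.
apply: (@Rintegral_gt0 _ _ _ _ _ mOmega _ O ((`|v z| / 2) ^+ 2)) => //.
- by move=> t _; exact: sqr_ge0.
- exact: open_measurable_rV.
- by move=> t [].
- exact: open_lebesgue_rV_gt0.
- by rewrite exprn_gt0// divr_gt0// normr_gt0.
move=> t [Ot /interior_subset/(_ (subset_closure Ot))/ltW tv].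
by rewrite -[leRHS]real_normK ?num_real// lerXn2r ?nnegrE.
Qed.

Lemma within_continuous_lincomb N (phi : 'I_N -> 'rV[R]_k -> R) (a : 'I_N -> R) A :
  (forall i, {within A, continuous phi i}) ->
  {within A, continuous (fun x => \sum_i a i * phi i x)}.
Proof.
move=> phic; apply/subspace_continuousP => z Az.
suff : forall s, (fun x => \sum_(i <- s) a i * phi i x) @ within A (nbhs z) -->
    \sum_(i <- s) a i * phi i z by exact.
elim=> [|i s IH].
  by rewrite big_nil; under eq_fun do rewrite big_nil; exact: cvg_cst.
rewrite big_cons; under eq_fun do rewrite big_cons; apply: cvgD IH.
by apply: cvgMr; move/subspace_continuousP : (phic i); exact.
Qed.

(** A coefficient [x i 0 != 0] is the value at [node i] of the corresponding
    finite element function. *)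
Lemma mass_matrix_posdef bc (T : mesh Omega) N (node : 'I_N -> 'rV[R]_k)
    (phi : 'I_N -> 'rV[R]_k -> R) :
  nodal_basis bc T node phi -> (forall i, L2 Omega (phi i)) ->
  posdefmx (mass_matrix Omega phi).
Proof.
move=> [node_vertex phi_fe phi_node _] phi2.
split=> [|x x0]; first exact: mass_matrix_sym.
have [i xi0] : exists i, x i 0 != 0.
  apply/existsP; apply: contraNT x0 => /existsPn x0.
  by apply/eqP/colP => i; rewrite mxE; apply/eqP; move: (x0 i); rewrite negbK.
rewrite -/(bform _ x x) bform_mass_matrix//.
apply: (@Rintegral_sqr_gt0 _ (node i)).
- by apply: within_continuous_lincomb => j; case: (phi_fe j).
- have [e [l ->]] := node_vertex i.
  by rewrite -(element_cover T); exists e => //; exact: vertex_element.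
- rewrite (bigD1 i)//= phi_node eqxx mulr1 big1 ?addr0// => j ji.
  by rewrite phi_node (negbTE ji) mulr0.
- exact: sqr_lincomb_integrable.
Qed.

End finite_element_matrices.

(** * Strong stability *)

Theorem corollary4 (R : realType) (k N : nat) (alpha c tau : R)
    (bc : boundary_condition) (Omega : set 'rV[R]_k)
    (d : 'rV[R]_k -> 'M[R]_k) (T : mesh Omega)
    (node : 'I_N -> 'rV[R]_k) (phi : 'I_N -> 'rV[R]_k -> R)
    (W : nat -> 'cV[R]_(N + N)) :
  0 < alpha -> 0 < c -> 0 < tau ->
  (1 <= k <= 3)%N ->
  bounded_domain Omega ->
  (bc = Periodic -> Omega = unit_cube) ->
  diffusion_tensor Omega d ->
  fe_space bc T `<=` H1 Omega ->
  nodal_basis bc T node phi ->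
  let M := mass_matrix Omega phi in
  let L := stiffness_matrix Omega d phi in
  fully_implicit alpha c tau M L W ->
  forall n, (1 <= n)%N ->
    cnorm c (sqrtmx (block_mass M) *m W n)
      <= cnorm c (sqrtmx (block_mass M) *m W n.-1).
Proof.
move=> alpha0 c0 tau0 _ [oOmega _ _ _] _ dd fe_H1 nodal M L scheme n n1.
have phi_H1 i : H1 Omega (phi i) by apply: fe_H1; case: nodal.
have pM : posdefmx M.
  by apply: (mass_matrix_posdef oOmega nodal) => i; case: (phi_H1 i).
have L0 x : 0 <= bform L x x by exact: stiffness_matrix_psd.
rewrite !cnorm_sqrtmx//; apply: ler_wsqrtr.
have [eU eV] := implicit_step_components (scheme n n1).
exact: (implicit_step_energy alpha0 c0 tau0 pM L0 eU eV).
Qed.
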